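(* Let $k,n\ge 2$ be integers, let $A_0,A_1,\dots,A_k$ be $n\times n$ generic matrices over $\mathbb{Q}$, let $K$ be the field generated over $\mathbb{Q}$ by all their entries and $\overline{K}$ its algebraic closure. The solvability complexity of the equation $$A_kX^k+\cdots+A_1X+A_0=0_n\qquad\text{in the unknown }X\in\mathcal{M}_n(\overline{K})$$ is $\left(\binom{kn}{n},S_{kn}\right)$.
   Context: Generic matrices: matrices whose entries, taken all together, are independent commuting indeterminates over $\mathbb{Q}$ (algebraically independent over $\mathbb{Q}$). Solvability complexity (SC): consider a matrix equation over $K$ with a finite number $\nu$ of solutions in $\mathcal{M}_n(\overline{K})$. Assume that finding the entries of each solution is equivalent to finding the roots of a polynomial (over $K$) whose Galois group over $K$ is $G$, in the sense that the extension of $K$ generated by the entries of all the solutions is the splitting field over $K$ of that polynomial. Then the solvability complexity of the equation is the couple $(\nu,G)$. $S_m$ denotes the symmetric group on $m$ letters. *)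

(* Defs.v *)
From HB Require Import structures.
From mathcomp Require Import all_boot all_order all_fingroup all_algebra.
From mathcomp Require Import all_solvable all_field.
From mathcomp Require Import mpoly.

Set Implicit Arguments.
Unset Strict Implicit.
Unset Printing Implicit Defensive.

Import GRing.Theory.
Local Open Scope ring_scope.

(* Multinomials are indexed by an ordinal type, so the finite index type I is
   enumerated; [ratr] is the embedding of the rationals when K has
   characteristic 0. *)
Definition algebraically_independent (K : fieldType) (I : finType)
    (a : I -> K) : Prop :=
  forall p : {mpoly rat[#|I|]}, mmap ratr (fun i => a (enum_val i)) p = 0 ->
    p = 0.

(* A divring-closed subset contains 1, hence the whole prime field, which is
   the field of rationals in characteristic 0. *)
Definition field_generated_by (K : fieldType) (I : finType)
    (a : I -> K) : Prop :=
  forall E : {pred K}, GRing.divring_closed E -> (forall i, a i \in E) ->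
    forall x : K, x \in E.

Definition all_entries (K : fieldType) (k n : nat) (A : 'I_k.+1 -> 'M[K]_n)
    (u : 'I_k.+1 * 'I_n * 'I_n) : K :=
  A u.1.1 u.1.2 u.2.

Definition generic_matrices (K : fieldType) (k n : nat)
    (A : 'I_k.+1 -> 'M[K]_n) : Prop :=
  [pchar K] =i pred0 /\ algebraically_independent (all_entries A).

Definition is_algebraic_closure (K : fieldType) (Kbar : closedFieldType)
    (iota : {rmorphism K -> Kbar}) : Prop :=
  forall x : Kbar, algebraicOver iota x.

Definition entries_of (R : Type) (n : nat) (s : seq 'M[R]_n) : seq R :=
  [seq X ij.1 ij.2 | X : 'M[R]_n <- s, ij <- enum {: 'I_n * 'I_n}].

(* The equation is given by its set of solutions over the algebraic closure
   Kbar of K. The extension of K generated inside Kbar by the entries of all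
   the solutions is represented by L, embedded by j: the entries are the images
   of the sequence es, and <<1 & es>> is the extension of K generated by es. The
   equality <<1 & es>> = {:L} makes j an isomorphism over K from L onto that
   extension. *)
Definition solvability_complexity (K : fieldType) (Kbar : closedFieldType)
    (iota : {rmorphism K -> Kbar}) (n : nat) (eqn : 'M[Kbar]_n -> Prop)
    (nu : nat) (gT : finGroupType) (G : {group gT}) : Prop :=
  exists sols : seq 'M[Kbar]_n,
    [/\ uniq sols,
        forall X, X \in sols <-> eqn X,
        size sols = nu
      & exists (p : {poly K}) (L : splittingFieldType K)
               (j : {rmorphism L -> Kbar}) (es : seq L),
          [/\ forall c : K, j c%:A = iota c,
              map j es = entries_of sols,
              <<1 & es>>%VS = {:L}%VS,
              splittingFieldFor 1 (map_poly (in_alg L) p) {:L}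
            & 'Gal({:L} / 1) \isog G]].

(* Main.v *)
(* Let P(x) = sum_l x^l A_l, let p = det P, of degree N = kn, and let z_0, ..,
   z_(N-1) be the roots of p. If X is a solvent, then P(x) = Q(x) (x - X), so
   the characteristic polynomial of X divides p, and X v = z v implies
   P(z) v = 0. When p has simple roots, ker P(z_i) is a line spanned by v_i,
   and any n of the v_i are independent, the solvents are therefore the
   matrices X_S indexed by the n-subsets S of the roots and determined by
   X_S v_i = z_i v_i for i in S.

   The Galois group of p over K is the full symmetric group. A relation
   F(a, z) = 0 between the entries a of the A_l and the roots gives, by taking
   the product over all permutations of the roots, a relation between the
   entries, which survives every specialization of a. Since p is linear in the
   first row of P and generic in it, there is a specialization a' of a with
   entries symmetric in indeterminates x_i whose determinant has roots x_i, and
   which is mapped back to a by x_i := z_i. The trace of prod_i (c z_i)^i,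
   where c is the leading coefficient of p, lies in K, hence is a rational
   function of a; specializing, the sum of prod_i x_(s i)^i over the Galois
   group is a symmetric polynomial, so that all permutations occur.

   The full symmetric group then yields the rest. It is transitive on the
   roots, so the polynomial vector v(x) = adj P(x) e_0, of degree < N, vanishes
   at none of them, and ker P(z_i) is the line spanned by v(z_i). A row w
   orthogonal to all the v(z_i) makes w adj P(x) vanish at N points, so w = 0;
   hence some n of the v(z_i) are independent, and by symmetry any n are.
   Finally an automorphism fixing all the X_S stabilizes every n-subset of the
   roots, hence is the identity. *)

Require Import Defs.
From HB Require Import structures.
From mathcomp Require Import all_boot all_order all_fingroup all_algebra.
From mathcomp Require Import all_solvable all_field.
From mathcomp Require Import mpoly.
From Stdlib Require Import ClassicalEpsilon.

Set Implicit Arguments.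
Unset Strict Implicit.
Unset Printing Implicit Defensive.

Import GRing.Theory.
Local Open Scope ring_scope.

(** * Polynomial relations between the roots of a polynomial *)

Lemma mmap_comp (n : nat) (R : nzRingType) (S S' : comNzRingType)
    (f : {rmorphism R -> S}) (h : 'I_n -> S) (g : {rmorphism S -> S'}) p :
  g (mmap f h p) = mmap (g \o f) (g \o h) p.
Proof.
rewrite /mmap rmorph_sum; apply: eq_bigr => m _ /=.
by rewrite rmorphM rmorph_prod; congr (_ * _); apply: eq_bigr => i _; rewrite rmorphXn.
Qed.

Lemma eq_mmap (n : nat) (R S : nzRingType) (f f' : R -> S) (h h' : 'I_n -> S) :
  f =1 f' -> h =1 h' -> mmap f h =1 mmap f' h'.
Proof.
move=> ef eh p; apply: eq_bigr => m _; rewrite ef; congr (_ * _).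
by apply: eq_bigr => i _; rewrite eh.
Qed.

Lemma mmap_msym (n : nat) (R S : comNzRingType) (f : {rmorphism R -> S})
    (h : 'I_n -> S) (s : 'S_n) p :
  mmap f h (msym s p) = mmap f (h \o s) p.
Proof.
rewrite /msym mmap_comp; apply: eq_mmap => [c|i] /=; first by rewrite mmapC.
by rewrite mmapX mmap1U.
Qed.

Lemma mmap_mesym (n k : nat) (R S : comNzRingType) (f : {rmorphism R -> S})
    (h : 'I_n -> S) :
  mmap f h (mesym n R k) = \sum_(A : {set 'I_n} | #|A| == k) \prod_(i in A) h i.
Proof.
rewrite /mesym rmorph_sum; apply: eq_bigr => A _.
by rewrite rmorph_prod; apply: eq_bigr => i _; rewrite /= mmapX mmap1U.
Qed.

Lemma mmap_mesymZ (n k : nat) (R S : comNzRingType) (f : {rmorphism R -> S})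
    (c : S) (h : 'I_n -> S) :
  mmap f (fun i => c * h i) (mesym n R k) = c ^+ k * mmap f h (mesym n R k).
Proof.
rewrite !mmap_mesym mulr_sumr; apply: eq_bigr => A /eqP <-.
by rewrite big_split /= prodr_const.
Qed.

Lemma mmap_comp_mpoly (n k : nat) (R S : comNzRingType) (f : {rmorphism R -> S})
    (h : 'I_k -> S) (t : n.-tuple {mpoly R[k]}) p :
  mmap f h (p \mPo t) = mmap f (fun i => mmap f h (tnth t i)) p.
Proof.
rewrite /comp_mpoly mmap_comp; apply: eq_mmap => [c|i] //=; exact: mmapC.
Qed.

(* Scaling the roots by the leading coefficient makes them integral, so that
   their symmetric functions are values of ring elements. *)
Lemma mesym_scaled_roots (R : comNzRingType) (L : idomainType) (N : nat)
    (f : {rmorphism R -> L}) (p : {poly R}) (z : 'I_N -> L) (k : 'I_N) :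
  map_poly f p = (f p`_N)%:P * \prod_(i < N) ('X - (z i)%:P) ->
  mmap f (fun i => f p`_N * z i) (mesym N R k.+1)
  = f ((-1) ^+ k.+1 * p`_(N - k.+1) * p`_N ^+ k).
Proof.
move=> pE; have ltk : (k.+1 < N.+1)%N by rewrite ltnS.
have prodE : \prod_(c <- [tuple z i | i < N]) ('X - c%:P) = \prod_(i < N) ('X - (z i)%:P).
  by rewrite big_map big_enum.
have := mroots_coeff [tuple z i | i < N] (Ordinal ltk); rewrite prodE /=.
move=> Vk; rewrite mmap_mesymZ !rmorphM /=.
have -> : f p`_(N - k.+1) = f p`_N * ((-1) ^+ k.+1 * (mesym N L k.+1).@[tnth [tuple z i | i < N]]).
  by rewrite -Vk -coefCM -pE coef_map.
rewrite !rmorphXn rmorphN1.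
have -> : (mesym N L k.+1).@[tnth [tuple z i | i < N]] = mmap f z (mesym N R k.+1).
  rewrite mmap_mesym /meval mmap_mesym; apply: eq_bigr => A _.
  by apply: eq_bigr => i _; rewrite tnth_mktuple.
move: (mmap f z _) => e; rewrite mulrCA [X in _ * X * _]mulrA -exprMn mulrNN.
by rewrite mulr1 expr1n mul1r exprS mulrAC.
Qed.

(* The product of all the conjugates of F is a polynomial in the elementary
   symmetric functions, so its vanishing is a relation between coefficients. *)
Lemma root_relation_transfer (R L T : idomainType) (N : nat)
    (f : {rmorphism R -> L}) (g : {rmorphism R -> T}) (p : {poly R})
    (z : 'I_N -> L) (x : 'I_N -> T) (F : {mpoly R[N]}) :
  injective f ->
  map_poly f p = (f p`_N)%:P * \prod_(i < N) ('X - (z i)%:P) ->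
  map_poly g p = (g p`_N)%:P * \prod_(i < N) ('X - (x i)%:P) ->
  mmap f (fun i => f p`_N * z i) F = 0 ->
  exists s : 'S_N, mmap g (fun i => g p`_N * x (s i)) F = 0.
Proof.
move=> finj fp gp F0; pose F' := \prod_(s : 'S_N) msym s F.
have F'sym : F' \is symmetric.
  apply/issymP => t; rewrite /F' rmorph_prod /= [RHS](reindex_inj (mulIg t)) /=.
  by apply: eq_bigr => s _; rewrite msymMm.
have [G [GE _]] := sym_fundamental F'sym.
pose E (k : 'I_N) := (-1) ^+ k.+1 * p`_(N - k.+1) * p`_N ^+ k.
pose GEv := mmap idfun E G.
(* At the scaled roots of any image of [p], the symmetric [F'] takes the image of the same element
   [GEv] of [R]. *)
have key (S : idomainType) (h : {rmorphism R -> S}) (y : 'I_N -> S) :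
    map_poly h p = (h p`_N)%:P * \prod_(i < N) ('X - (y i)%:P) ->
    mmap h (fun i => h p`_N * y i) F' = h GEv.
  move=> hp; rewrite -GE mmap_comp_mpoly mmap_comp; apply: eq_mmap => // i.
  by rewrite tnth_mktuple mesym_scaled_roots.
(* The identity permutation contributes the factor [F], so [GEv] is killed by the injective [f]. *)
have : GEv = 0.
  apply: finj; rewrite -(key _ _ _ fp) rmorph0 rmorph_prod (bigD1 1%g) //= msym1m.
  by rewrite F0 mul0r.
move/(congr1 g); rewrite -(key _ _ _ gp) rmorph0 rmorph_prod => /eqP.
by case/prodf_eq0 => s _ /=; rewrite mmap_msym => /eqP ?; exists s.
Qed.

Lemma size_prod_roots (R : idomainType) (N : nat) (x : 'I_N -> R) :
  size (\prod_(i < N) ('X - (x i)%:P)) = N.+1.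
Proof. by rewrite size_prod_XsubC /index_enum -enumT size_enum_ord. Qed.

Lemma lead_prod_roots (R : idomainType) (N : nat) (x : 'I_N -> R) :
  (\prod_(i < N) ('X - (x i)%:P))`_N = 1.
Proof.
have /eqP := monic_prod_XsubC (index_enum 'I_N) xpredT x.
by rewrite /lead_coef size_prod_roots.
Qed.

(** * Determinants of matrix polynomials *)

Section MatrixPolynomials.

Variables (n k : nat).

Definition mxp (R : nzRingType) (A : 'I_k.+1 -> 'M[R]_n) : 'M[{poly R}]_n :=
  \matrix_(i, j) \poly_(l < k.+1) A (inord l) i j.

Lemma mxpE (R : nzRingType) (A : 'I_k.+1 -> 'M[R]_n) i j (l : 'I_k.+1) :
  (mxp A i j)`_l = A l i j.
Proof. by rewrite mxE coef_poly ltn_ord inord_val. Qed.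

Lemma size_mxp (R : nzRingType) (A : 'I_k.+1 -> 'M[R]_n) i j :
  (size (mxp A i j) <= k.+1)%N.
Proof. by rewrite mxE size_poly. Qed.

Lemma mxp_map (R S : nzRingType) (f : {rmorphism R -> S})
    (A : 'I_k.+1 -> 'M[R]_n) :
  mxp (fun l => map_mx f (A l)) = map_mx (map_poly f) (mxp A).
Proof.
apply/matrixP => i j; rewrite !mxE; apply/polyP => l.
by rewrite coef_map !coef_poly mxE; case: ifP => // _; rewrite raddf0.
Qed.

Lemma horner_mxp (R : comNzRingType) (A : 'I_k.+1 -> 'M[R]_n) x :
  map_mx (horner_eval x) (mxp A) = \sum_(l < k.+1) x ^+ l *: A l.
Proof.
apply/matrixP => i j; rewrite !mxE /horner_eval horner_poly summxE.
by apply: eq_bigr => l _; rewrite mxE inord_val mulrC.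
Qed.

Definition detp (R : comNzRingType) (A : 'I_k.+1 -> 'M[R]_n) : {poly R} :=
  \det (mxp A).

Lemma detp_map (R S : comNzRingType) (f : {rmorphism R -> S})
    (A : 'I_k.+1 -> 'M[R]_n) :
  detp (fun l => map_mx f (A l)) = map_poly f (detp A).
Proof. by rewrite /detp mxp_map det_map_mx. Qed.

End MatrixPolynomials.

Lemma size_det_poly (R : idomainType) (n k : nat) (B : 'M[{poly R}]_n) :
  (forall i j, (size (B i j) <= k.+1)%N) -> (size (\det B) <= (k * n).+1)%N.
Proof.
move=> szB; rewrite /determinant.
apply: (leq_trans (size_sum _ _ _)); apply/bigmax_leqP => s _.
rewrite mulr_sign.
rewrite (fun_if (fun q : {poly R} => size q)) size_polyN if_same.
have [p0|nz] := eqVneq (\prod_i B i (s i)) 0; first by rewrite p0 size_poly0.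
rewrite size_prod; last by move=> i _; apply: contraNneq nz => B0; rewrite (bigD1 i) //= B0 mul0r.
rewrite card_ord leq_subLR addnS ltnS.
have -> : (n + k * n = \sum_(i < n) k.+1)%N by rewrite sum_nat_const card_ord mulnS mulnC.
by apply: leq_sum => i _.
Qed.

Lemma size_detp (R : idomainType) (n k : nat) (A : 'I_k.+1 -> 'M[R]_n) :
  (size (detp A) <= (k * n).+1)%N.
Proof. by apply: size_det_poly => i j; apply: size_mxp. Qed.

Lemma size_cofactor_mxp (R : idomainType) (n k : nat) (A : 'I_k.+1 -> 'M[R]_n)
    i j :
  (size (cofactor (mxp A) i j) <= (k * n.-1).+1)%N.
Proof.
rewrite /cofactor -signr_odd mulr_sign (fun_if (fun q : {poly R} => size q)).
rewrite size_polyN if_same; apply: size_det_poly => i' j'.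
by rewrite 2!mxE size_mxp.
Qed.

(** * Deforming the first row of a matrix polynomial *)

Section RowDeformation.

Variables (n k : nat).
Hypothesis k_gt0 : (0 < k)%N.
Local Notation N := (k * n.+1)%N.

Definition colidx (m : 'I_N) : 'I_n.+1 := inord (m %/ k).

Lemma colidxE (m : 'I_N) : colidx m = (m %/ k)%N :> nat.
Proof. by rewrite inordK // ltn_divLR // -[X in (_ < X)%N]mulnC. Qed.

(* The coefficients of the variations of [detp A] obtained by adding
   [X^(m %% k)] to the entry of the first row in column [m %/ k]. *)
Definition varmx (R : comNzRingType) (A : 'I_k.+1 -> 'M[R]_n.+1) : 'M[R]_N :=
  \matrix_(m, m') ('X^(m %% k) * cofactor (mxp A) ord0 (colidx m))`_m'.

Lemma varmx_map (R S : comNzRingType) (f : {rmorphism R -> S})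
    (A : 'I_k.+1 -> 'M[R]_n.+1) :
  varmx (fun l => map_mx f (A l)) = map_mx f (varmx A).
Proof.
apply/matrixP => m m'; rewrite !mxE -coef_map rmorphM /= map_polyXn.
by rewrite mxp_map cofactor_map_mx.
Qed.

(* Lower bidiagonal with determinant 1, and mapping the column of the powers
   of [X^k] to the first basis vector. *)
Definition bidiag (l : 'I_k.+1) : 'M[int]_n.+1 :=
  \matrix_(i, j) (((l == 0 :> nat) && (i == j))%:R
                  - ((l == k :> nat) && (i == j.+1 :> nat))%:R).

Lemma mxp_bidiag i j :
  mxp bidiag i j = (i == j)%:R - 'X^k * (i == j.+1 :> nat)%:R.
Proof.
rewrite mxE; apply/polyP => l; rewrite coef_poly mxE.
rewrite -!polyC_natr coefB coefMC coefXn coefC.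
case: ltnP => lk.
  rewrite inordK //; congr (_ - _).
    by case: eqP; case: eqP.
  by rewrite -natrM mulnb.
by rewrite (gtn_eqF lk) (gtn_eqF (leq_ltn_trans _ lk)) // mul0r subrr.
Qed.

(** The inverse of the bidiagonal matrix sends the first basis vector to the powers of ['X^k], so
    these are its first-row cofactors; times ['X^(m %% k)] they give ['X^m], and [varmx] is the
    identity. *)
Lemma det_varmx_bidiag : \det (varmx bidiag) = 1.
Proof.
have detB1 : \det (mxp bidiag) = 1.
  rewrite det_trig; last first.
    apply/is_trig_mxP => i j ij; rewrite mxp_bidiag.
    rewrite (_ : (i == j) = false); last by rewrite -val_eqE /= ltn_eqF.
    by rewrite (ltn_eqF (leqW ij)) mulr0 subr0.
  by rewrite big1 // => i _; rewrite mxp_bidiag eqxx ltn_eqF // mulr0 subr0.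
pose u : 'cV[{poly int}]_n.+1 := \col_j 'X^(k * j).
have mulu : mxp bidiag *m u = delta_mx ord0 ord0.
  apply/matrixP => i j; rewrite !mxE ord1 eqxx andbT.
  under eq_bigr => a _ do rewrite mxp_bidiag mxE mulrBl.
  rewrite sumrB (bigD1 i) //= eqxx mul1r [X in _ + X - _]big1 => [|a ia]; last first.
    by rewrite eq_sym (negbTE ia) mul0r.
  rewrite addr0; case: (unliftP ord0 i) => [i'|] -> /=.
    rewrite (bigD1 (widen_ord (leqnSn _) i')) //= eqxx mulr1 -exprD -mulnS.
    rewrite big1 => [|a ia]; last first.
      rewrite (_ : (bump 0 i' == a.+1) = false) ?mulr0 ?mul0r //.
      by apply: contraNF ia => /eqP[ia]; apply/eqP/val_inj.
    by rewrite addr0 /bump leq0n add1n subrr.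
  by rewrite muln0 expr0 big1 ?subr0 // => a _; rewrite mulr0 mul0r.
have cofE j : cofactor (mxp bidiag) ord0 j = 'X^(k * j).
  have : \adj (mxp bidiag) *m (mxp bidiag *m u) = u.
    by rewrite mulmxA mul_adj_mx detB1 mul1mx.
  rewrite mulu => /matrixP/(_ j ord0); rewrite !mxE => <-.
  rewrite (bigD1 ord0) //= !mxE big1 => [|a /negbTE a0]; first by rewrite mulr1 addr0.
  by rewrite !mxE a0 mulr0.
have -> : varmx bidiag = 1%:M; last by rewrite det1.
apply/matrixP => m m'; rewrite !mxE cofE -exprD coefXn colidxE.
by rewrite addnC (mulnC k (m %/ k)%N) -divn_eq eq_sym.
Qed.

(** Only coefficients of degree below [k] are perturbed: there are as many parameters as
    coefficients of [detp] below degree [N]. *)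
Definition addrow (R : nzRingType) (A : 'I_k.+1 -> 'M[R]_n.+1) (e : 'I_N -> R) :
    'I_k.+1 -> 'M[R]_n.+1 :=
  fun l => A l + \matrix_(i, j)
    \sum_(m < N | [&& i == ord0, colidx m == j & (l == (m %% k)%N :> nat)]) e m.

Lemma mxp_addrow0 (R : nzRingType) (A : 'I_k.+1 -> 'M[R]_n.+1) e j :
  mxp (addrow A e) ord0 j =
  mxp A ord0 j + \sum_(m < N | colidx m == j) (e m)%:P * 'X^(m %% k).
Proof.
apply/polyP => l; rewrite coefD coef_sum [mxp (addrow A e) _ _]mxE coef_poly.
case: ltnP => lk; last first.
  rewrite nth_default ?(leq_trans (size_mxp _ _ _)) // add0r big1 // => m _.
  rewrite coefCM coefXn gtn_eqF ?mulr0 // (leq_trans _ lk) // ltnS ltnW //.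
  by rewrite ltn_mod.
rewrite 2!mxE -[l in RHS](@inordK k) // mxpE eqxx /=; congr (_ + _).
rewrite big_mkcondr /=; apply: eq_bigr => m _.
by rewrite coefCM coefXn; case: ifP => _; rewrite ?mulr1 ?mulr0.
Qed.

(** The cofactors along the first row do not see that row, so the determinant is affine in the
    perturbation. *)
Lemma detp_addrow (R : comNzRingType) (A : 'I_k.+1 -> 'M[R]_n.+1) e :
  detp (addrow A e) = detp A +
    \sum_(m < N) (e m)%:P * ('X^(m %% k) * cofactor (mxp A) ord0 (colidx m)).
Proof.
have cofE j : cofactor (mxp (addrow A e)) ord0 j = cofactor (mxp A) ord0 j.
  rewrite /cofactor; congr (_ * \det _); apply/matrixP => i' j'.
  rewrite !mxE; apply/polyP => l; rewrite !coef_poly; case: ifP => // _.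
  by rewrite 2!mxE big_pred0 ?addr0.
rewrite /detp !(expand_det_row _ ord0).
under eq_bigr => j _ do rewrite cofE mxp_addrow0 mulrDl.
rewrite big_split /=; congr (_ + _).
rewrite [RHS](partition_big (@colidx) xpredT) //=; apply: eq_bigr => j _.
by rewrite mulr_suml; apply: eq_bigr => m /eqP ->; rewrite mulrA.
Qed.

Lemma poly_var_size (R : idomainType) (A : 'I_k.+1 -> 'M[R]_n.+1) (m : 'I_N) :
  (size ('X^(m %% k) * cofactor (mxp A) ord0 (colidx m))%R <= N)%N.
Proof.
apply: leq_trans (size_polyMleq _ _) _; rewrite size_polyXn addSn /=.
have := size_cofactor_mxp A ord0 (colidx m); rewrite /= => szc.
have ltmk : (m %% k <= k.-1)%N by rewrite -ltnS prednK // ltn_mod.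
by apply: leq_trans (leq_add ltmk szc) _; rewrite addnS -addSn prednK // mulnS.
Qed.

(** Prescribing the determinant is a linear system with matrix [varmx A], invertible over [L]. Its
    right-hand side [D] is symmetric and vanishes at [z], hence so does the solution [e]. *)
Lemma generic_root_deformation (L : fieldType) (A : 'I_k.+1 -> 'M[L]_n.+1)
    (c : L) (z : 'I_N -> L) :
  \det (varmx A) != 0 -> detp A = c%:P * \prod_(i < N) ('X - (z i)%:P) ->
  exists A' : 'I_k.+1 -> 'M[{mpoly L[N]}]_n.+1,
    [/\ forall l i j, A' l i j \is symmetric,
        forall l i j, (A' l i j).@[z] = A l i j
      & detp A' = (c%:MP)%:P * \prod_(i < N) ('X - ('X_i)%:P)].
Proof.
move=> nzdet pE; pose iota := @mpolyC N L.
pose P' : {poly {mpoly L[N]}} := (c%:MP)%:P * \prod_(i < N) ('X - ('X_i)%:P).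
pose D := P' - map_poly iota (detp A).
have Dhigh m : (N <= m)%N -> D`_m = 0.
  rewrite leq_eqVlt => /orP[/eqP <-|ltm].
    by rewrite coefB coef_map pE !coefCM !lead_prod_roots !mulr1 subrr.
  rewrite coefB coef_map pE !coefCM !nth_default ?size_prod_roots // !mulr0.
  by rewrite /= mpolyC0 subrr.
pose d : 'rV[{mpoly L[N]}]_N := \row_m D`_m.
pose e := d *m map_mx iota (invmx (varmx A)).
have dsym m : d ord0 m \is symmetric.
  rewrite mxE; apply/issymP => s; rewrite coefB raddfB coef_map /=.
  rewrite {2}/msym mmapC; congr (_ - _); rewrite -coef_map; congr (_`__).
  have prod_msym : map_poly (msym s) (\prod_(i < N) ('X - ('X_i)%:P))
                 = \prod_(i < N) ('X - ('X_i : {mpoly L[N]})%:P).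
    rewrite rmorph_prod /= [RHS](reindex_inj (@perm_inj _ s)) /=.
    by apply: eq_bigr => i _; rewrite map_polyXsubC /= /msym mmapX mmap1U.
  by rewrite /P' rmorphM /= prod_msym map_polyC /= /msym mmapC.
have esym m : e ord0 m \is symmetric.
  rewrite mxE rpred_sum // => j _; rewrite !mxE mulrC mul_mpolyC rpredZ //.
  by have := dsym j; rewrite mxE.
have D0 : map_poly (meval z) D = 0.
  have mapP : map_poly (meval z) P' = c%:P * \prod_(i < N) ('X - (z i)%:P).
    rewrite /P' rmorphM /= map_polyC /= mevalC rmorph_prod; congr (_ * _).
    by apply: eq_bigr => i _ /=; rewrite map_polyXsubC /= mevalXU.
  have mapA : map_poly (meval z) (map_poly iota (detp A)) = detp A.
    by apply/polyP => i; rewrite !coef_map /= mevalC.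
  by rewrite rmorphB /= mapP mapA pE subrr.
have e0 m : (e ord0 m).@[z] = 0.
  rewrite mxE raddf_sum big1 //= => j _; rewrite mevalM mxE.
  by rewrite -[(D`_j).@[z]]coef_map D0 coef0 mul0r.
exists (addrow (fun l => map_mx iota (A l)) (e ord0)); split=> [l i j|l i j|].
- rewrite !mxE rpredD ?rpred_sum //.
  by apply/issymP => s; rewrite /msym mmapC.
- by rewrite !mxE mevalD mevalC raddf_sum /= big1 ?addr0.
rewrite detp_addrow detp_map -/P' -[P'](subrK (map_poly iota (detp A))) -/D.
rewrite addrC; congr (_ + _); apply/polyP => m; rewrite coef_sum.
case: (ltnP m N) => ltm; last first.
  rewrite Dhigh // big1 // => m' _; rewrite coefCM nth_default ?mulr0 //.
  by rewrite (leq_trans (poly_var_size _ _)).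
have : e *m varmx (fun l => map_mx iota (A l)) = d.
  rewrite varmx_map -mulmxA -map_mxM mulVmx ?map_mx1 ?mulmx1 //.
  by rewrite unitmxE unitfE.
move/matrixP/(_ ord0 (Ordinal ltm)); rewrite !mxE /= => <-.
by apply: eq_bigr => m' _; rewrite coefCM !mxE.
Qed.

End RowDeformation.

(** * Generic matrices and the Galois group *)

Section GenericMatrices.

Variables (n k : nat).
Local Notation I := ('I_k.+1 * 'I_n * 'I_n)%type.
Local Notation Z_ := {mpoly int[#|{: I}|]}.

(* Integer coefficients are enough, and [intr] is a morphism to every ring,
   whereas [ratr] is only one to numeric fields in the library. *)
Definition genmx (l : 'I_k.+1) : 'M[Z_]_n :=
  \matrix_(i, j) 'X_(enum_rank (l, i, j)).

Section Specialization.

Variables (S : comNzRingType) (B : 'I_k.+1 -> 'M[S]_n).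

Definition spec : Z_ -> S :=
  mmap (intr : int -> S) (fun q => let u := enum_val q in B u.1.1 u.1.2 u.2).

HB.instance Definition _ := GRing.RMorphism.on spec.

Lemma spec_genmx l : map_mx spec (genmx l) = B l.
Proof. by apply/matrixP => i j; rewrite !mxE /spec mmapX mmap1U enum_rankK. Qed.

Lemma spec_detp : map_poly spec (detp genmx) = detp B.
Proof.
rewrite -detp_map; congr (\det _); apply/matrixP => i j; rewrite !mxE.
by apply/polyP => l; rewrite !coef_poly spec_genmx.
Qed.

End Specialization.

Lemma spec_comp (S T : comNzRingType) (h : {rmorphism S -> T})
    (B : 'I_k.+1 -> 'M[S]_n) u :
  h (spec B u) = spec (fun l => map_mx h (B l)) u.
Proof.
by rewrite /spec mmap_comp; apply: eq_mmap => [m|i] /=; rewrite ?rmorph_int ?mxE.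
Qed.

Lemma spec_inj (K : fieldType) (A : 'I_k.+1 -> 'M[K]_n) :
  algebraically_independent (all_entries A) -> injective (spec A).
Proof.
move=> ai; apply: raddf_inj => p p0.
have inj_int : injective (intr : int -> rat) by apply: intr_inj.
have : map_mpoly (intr : int -> rat) p = 0.
  apply: ai; rewrite -[RHS]p0 /spec /mmap.
  rewrite (perm_big _ (msupp_map_mpoly _ inj_int)) /=.
  by apply: eq_bigr => m _; rewrite mcoeff_map_mpoly /= ratr_int.
move=> pQ0; apply/mpolyP => m; apply: inj_int.
by rewrite -mcoeff_map_mpoly pQ0 !mcoeff0.
Qed.

(** One specialization where the coefficient survives is enough: the identity in degree [k], zero
    elsewhere. *)
Lemma lead_detp_genmx : (detp genmx)`_(k * n) != 0.
Proof.
pose B (l : 'I_k.+1) : 'M[int]_n := ((l == k :> nat)%:R)%:M.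
have detB : detp B = 'X^(k * n).
  have -> : detp B = \det ('X^k%:M : 'M[{poly int}]_n).
    congr (\det _); apply/matrixP => i j; rewrite !mxE.
    apply/polyP => l; rewrite coef_poly coefMn coefXn !mxE.
    case: ltnP => lk; first by rewrite inordK.
    by rewrite gtn_eqF // mul0rn.
  by rewrite det_scalar exprM.
apply/eqP => /(congr1 (spec B)); rewrite -coef_map spec_detp detB coefXn eqxx.
by rewrite rmorph0 => /eqP; rewrite oner_eq0.
Qed.

End GenericMatrices.

Lemma det_varmx_genmx n k : (0 < k)%N -> \det (varmx (@genmx n.+1 k)) != 0.
Proof.
move=> k0; apply/eqP => /(congr1 (spec (@bidiag n k))).
rewrite rmorph0 -det_map_mx -varmx_map => /eqP; apply/negP.
have -> : varmx (fun l => map_mx (spec (@bidiag n k)) (genmx n.+1 l)) = varmx (@bidiag n k).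
  apply/matrixP => m m'; rewrite !mxE /cofactor; congr (('X^_ * (_ * \det _))`__).
  apply/matrixP => i j; rewrite !mxE; apply/polyP => l.
  by rewrite !coef_poly spec_genmx.
by rewrite det_varmx_bidiag // oner_eq0.
Qed.

(** The quotients of values of [spec A] form a subfield containing all entries. *)
Lemma spec_fraction n k (K : fieldType) (A : 'I_k.+1 -> 'M[K]_n) (x : K) :
  injective (spec A) -> field_generated_by (all_entries A) ->
  exists u w, w != 0 /\ spec A w * x = spec A u.
Proof.
move=> injA genA.
pose P (y : K) := exists u w, w != 0 /\ spec A w * y = spec A u.
pose E : {pred K} := fun y => if excluded_middle_informative (P y) then true else false.
have EP y : reflect (P y) (y \in E).
  by rewrite unfold_in /E; case: excluded_middle_informative => h; constructor.
apply/EP; apply: (genA E) => [|[[l i] j]]; last first.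
  apply/EP; exists (genmx n l i j), 1; split; first exact: oner_neq0.
  by rewrite rmorph1 mul1r; have /matrixP/(_ i j) := spec_genmx A l; rewrite mxE.
split.
- by apply/EP; exists 1, 1; rewrite oner_neq0 mulr1.
- move=> y1 y2 /EP[u1 [w1 [nz1 e1]]] /EP[u2 [w2 [nz2 e2]]]; apply/EP.
  exists (u1 * w2 - u2 * w1), (w1 * w2); split; first by rewrite mulf_neq0.
  rewrite rmorphB !rmorphM /= -e1 -e2 mulrBr mulrAC.
  by rewrite [spec A w1 * spec A w2]mulrC [_ * spec A w1 * y2]mulrAC.
move=> y1 y2 /EP[u1 [w1 [nz1 e1]]] /EP[u2 [w2 [nz2 e2]]]; apply/EP.
(* The inverse of 0 is 0, which is the fraction 0 over 1. *)
have [y20|nz] := eqVneq y2 0.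
  by exists 0, 1; rewrite oner_neq0 y20 invr0 !mulr0 rmorph0.
exists (u1 * w2), (w1 * u2); split.
  rewrite mulf_neq0 //; apply: contra_neq nz => u20.
  move/eqP: e2; rewrite u20 rmorph0 mulf_eq0 => /orP[|/eqP //].
  by rewrite -(rmorph0 (spec A)) => /eqP/injA/eqP; rewrite (negbTE nz2).
rewrite !rmorphM /= -e1 -e2 [_ * (_ * y2)]mulrA mulrACA mulfV // mulr1.
by rewrite mulrAC.
Qed.

(** * The Galois group is the full symmetric group *)

Section GaloisGroup.

Variables (n k : nat) (K : fieldType) (A : 'I_k.+1 -> 'M[K]_n.+1).
Local Notation N := (k * n.+1)%N.
Variables (L : splittingFieldType K) (z : 'I_N -> L) (c : L).
Hypotheses (k_gt0 : (0 < k)%N) (hgen : generic_matrices A).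
Hypothesis (hK : field_generated_by (all_entries A)).
Hypothesis zE : map_poly (in_alg L) (detp A) = c%:P * \prod_(i < N) ('X - (z i)%:P).
Hypothesis zgen : <<1 & codom z>>%VS = {:L}%VS.

Let AL (l : 'I_k.+1) : 'M[L]_n.+1 := map_mx (in_alg L) (A l).

Let specAL u : spec AL u = (spec A u)%:A.
Proof. by rewrite -[RHS]/(in_alg L _) spec_comp. Qed.

Let specA_inj : injective (spec A).
Proof. by apply: spec_inj; case: hgen. Qed.

Let specAL_inj : injective (spec AL).
Proof.
by move=> u v; rewrite !specAL -!/(in_alg L _) => /fmorph_inj/specA_inj.
Qed.

Let specc : spec AL (detp (@genmx n.+1 k))`_N = c.
Proof.
by rewrite -coef_map spec_detp /AL detp_map zE coefCM lead_prod_roots mulr1.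
Qed.

Let c_neq0 : c != 0.
Proof.
rewrite -specc -(rmorph0 (spec AL)) (inj_eq specAL_inj).
exact: lead_detp_genmx.
Qed.

(** [g] specializes to the deformed matrices, whose determinant has the indeterminates as roots and
    the same leading coefficient [c]; [root_relation_transfer] then applies. *)
Lemma generic_specialization :
  exists g : {rmorphism {mpoly int[#|{: 'I_k.+1 * 'I_n.+1 * 'I_n.+1}|]} -> {mpoly L[N]}},
  [/\ forall u, g u \is symmetric,
      forall u, (g u).@[z] = spec AL u
    & forall F : {mpoly {mpoly int[#|{: 'I_k.+1 * 'I_n.+1 * 'I_n.+1}|]}[N]},
      mmap (spec AL) (fun i => c * z i) F = 0 ->
      exists s : 'S_N, mmap g (fun i => c%:MP * 'X_(s i)) F = 0].
Proof.
have nzdet : \det (varmx AL) != 0.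
  have -> : varmx AL = map_mx (spec AL) (varmx (@genmx n.+1 k)).
    rewrite -varmx_map; apply/matrixP => m m'; rewrite !mxE.
    rewrite /cofactor; congr (('X^_ * (_ * \det _))`__).
    apply/matrixP => i j; rewrite !mxE; apply/polyP => l.
    by rewrite !coef_poly spec_genmx.
  rewrite det_map_mx -(rmorph0 (spec AL)) (inj_eq specAL_inj).
  exact: det_varmx_genmx.
have ALE : detp AL = c%:P * \prod_(i < N) ('X - (z i)%:P) by rewrite /AL detp_map.
have [A' [symA' evA' A'E]] := generic_root_deformation k_gt0 nzdet ALE.
exists (spec A'); split=> [u|u|F F0].
- apply/issymP => s; rewrite -[RHS]/(spec A' u).
  rewrite /spec /msym mmap_comp; apply: eq_mmap => [m|q] /=.
    by rewrite rmorph_int.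
  exact/issymP.
- rewrite /spec -[LHS]/(meval z _) mmap_comp; apply: eq_mmap => [m|q] /=.
    by rewrite rmorph_int.
  by rewrite evA'.
have gc : spec A' (detp (@genmx n.+1 k))`_N = c%:MP.
  by rewrite -coef_map spec_detp A'E coefCM lead_prod_roots mulr1.
have [|||s] := @root_relation_transfer _ _ _ N (spec AL) (spec A')
  (detp (@genmx n.+1 k)) z (fun i => 'X_i) F specAL_inj.
- by rewrite spec_detp /= specc.
- by rewrite spec_detp /= gc.
- by rewrite /= specc.
by rewrite /= gc => s0; exists s.
Qed.

(** An equality [z i = z j] would transfer to the indeterminates of index [s i] and [s j]. *)
Lemma generic_roots_inj : injective z.
Proof.
move=> i j zij; have [g [_ _ transf]] := generic_specialization.
have [|s] := transf ('X_i - 'X_j).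
  by rewrite rmorphB /= !mmapX !mmap1U zij subrr.
rewrite rmorphB /= !mmapX !mmap1U -mulrBr => /eqP; rewrite mulf_eq0.
rewrite mpolyC_eq0 (negbTE c_neq0) subr_eq0 /= => /eqP.
move/(congr1 (meval (fun q => (q == s i)%:R))); rewrite !mevalXU eqxx => /eqP.
by rewrite (inj_eq (@perm_inj _ s)); case: (j =P i) => [->|_] //; rewrite oner_eq0.
Qed.

Let detpAL_eq0 x : root (map_poly (in_alg L) (detp A)) x -> exists i, x = z i.
Proof.
rewrite zE rootE hornerM hornerC mulf_eq0 (negbTE c_neq0) /= horner_prod.
by case/prodf_eq0 => i _; rewrite hornerXsubC subr_eq0 => /eqP; exists i.
Qed.

Lemma root_permutations : exists pi : gal_of {:L} -> 'S_N,
  forall (s : gal_of {:L}) i, s (z i) = z (pi s i).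
Proof.
have zs (s : gal_of {:L}) i : {m | s (z i) == z m}.
  apply: sigW; have [|m ->] := @detpAL_eq0 (s (z i)); last by exists m.
  suff -> : map_poly (in_alg L) (detp A) = map_poly s (map_poly (in_alg L) (detp A)).
    rewrite rootE horner_map zE hornerM horner_prod (bigD1 i) //=.
    by rewrite hornerXsubC subrr mul0r mulr0 rmorph0.
  by apply/polyP => m; rewrite !coef_map /= linearZ /= rmorph1.
have t_inj s : injective (fun i => sval (zs s i)).
  move=> i m /= eqt; apply: generic_roots_inj; apply: (fmorph_inj s).
  transitivity (z (sval (zs s i))); first exact: eqP (svalP (zs s i)).
  by rewrite eqt; apply/esym/(eqP (svalP (zs s m))).
exists (fun s => perm (@t_inj s)) => s i; rewrite permE.
exact: eqP (svalP (zs s i)).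
Qed.

(** In this monomial ['X_(s i)] has exponent [i]; the exponents being distinct, it determines
    [s]. *)
Let staircase (s : 'S_N) : 'X_{1..N} := [multinom (s^-1%g i : nat) | i < N].

Let staircaseE (s : 'S_N) (e : L) :
  \prod_(i < N) (e%:MP * 'X_(s i)) ^+ i
  = (e ^+ \sum_(i < N) i) *: ('X_[staircase s] : {mpoly L[N]}).
Proof.
rewrite -mul_mpolyC; under eq_bigr => i _ do rewrite exprMn.
rewrite big_split /= prodrXr rmorphXn; congr (_ * _).
rewrite mpolyXE_id [RHS](reindex_inj (@perm_inj _ s)) /=.
by apply: eq_bigr => i _;  rewrite mnmE permK.
Qed.

Let staircase_inj : injective staircase.
Proof.
move=> s t /mnmP eqst; apply: invg_inj; apply/permP => i.
by have := eqst i; rewrite !mnmE => /val_inj.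
Qed.

Lemma generic_splittingField :
  splittingFieldFor 1 (map_poly (in_alg L) (detp A)) {:L}.
Proof.
exists (codom z) => //; rewrite zE mul_polyC big_image /=.
exact: eqp_scale.
Qed.

Lemma generic_galois : galois 1 {:L}.
Proof.
apply/splitting_galoisField; exists (map_poly (in_alg L) (detp A)).
split; [exact: alg_polyOver | | exact: generic_splittingField].
rewrite zE mul_polyC (eqp_separable (eqp_scale _ c_neq0)).
have -> : \prod_(i < N) ('X - (z i)%:P) = \prod_(x <- codom z) ('X - x%:P).
  by rewrite big_image.
rewrite separable_prod_XsubC.
by rewrite map_inj_uniq ?enum_uniq //; apply: generic_roots_inj.
Qed.

(** The transferred trace relation makes a sum of one staircase monomial per automorphism symmetric;
    symmetry spreads the nonzero coefficient due to the identity to every permutation. *)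
Lemma generic_galois_full (t : 'S_N) :
  exists2 s, s \in ('Gal({:L} / 1))%g & forall i, s (z i) = z (t i).
Proof.
have [pi piE] := root_permutations.
have pi1 : pi 1%g = 1%g.
  apply/permP => i; apply: generic_roots_inj.
  by rewrite -piE gal_id perm1.
pose G := ('Gal({:L} / 1))%G; pose y := \prod_(i < N) (c * z i) ^+ i.
have yE s : s \in G -> s y = \prod_(i < N) (c * z (pi s i)) ^+ i.
  move=> sG; rewrite /y rmorph_prod; apply: eq_bigr => i _.
  rewrite rmorphXn rmorphM /= piE; congr ((_ * _) ^+ _).
  by rewrite -specc specAL linearZ /= rmorph1.
have [a yK] : exists a : K, \sum_(s in G) s y = a%:A.
  have : galTrace 1 {:L} y \in 1%VS by rewrite mem_galTrace ?generic_galois ?memvf.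
  by case/vlineP => a yE'; exists a.
have [u [w [w0 wE]]] := spec_fraction a specA_inj hK.
have [g [gsym gev transf]] := generic_specialization.
(* The relation saying that [w] times the trace is [u], with indeterminates for the scaled roots. *)
pose F : {mpoly {mpoly int[#|{: 'I_k.+1 * 'I_n.+1 * 'I_n.+1}|]}[N]} :=
  w%:MP * (\sum_(s in G) \prod_(i < N) 'X_(pi s i) ^+ i) - u%:MP.
have evF (S : idomainType) (h : {rmorphism {mpoly int[#|{: 'I_k.+1 * 'I_n.+1 * 'I_n.+1}|]} -> S}) (x : 'I_N -> S) :
    mmap h x F = h w * (\sum_(s in G) \prod_(i < N) x (pi s i) ^+ i) - h u.
  rewrite /F rmorphB rmorphM /= !mmapC rmorph_sum; congr (_ * _ - _).
  apply: eq_bigr => s _; rewrite rmorph_prod; apply: eq_bigr => i _.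
  by rewrite rmorphXn /= mmapX mmap1U.
have [|v] := transf F.
  rewrite evF -(eq_bigr _ yE) yK /= !specAL -wE mulr_algl scalerA.
  by rewrite subrr.
rewrite evF => /eqP; rewrite subr_eq0 => /eqP gE.
pose Q : {mpoly L[N]} := \sum_(s in G) 'X_[staircase (pi s * v)].
have Qsym : Q \is symmetric.
  pose e := c ^+ \sum_(i < N) i.
  have e0 : e != 0 by rewrite expf_neq0.
  have QE : e *: Q = \sum_(s in G) \prod_(i < N) (c%:MP * 'X_(v (pi s i))) ^+ i.
    rewrite /Q scaler_sumr; apply: eq_bigr => s _.
    by rewrite -staircaseE; apply: eq_bigr => i _; rewrite permM.
  have eQsym : e *: Q \is symmetric.
    (* The product with the symmetric [g w] is the symmetric [g u], and [g w] is nonzero because its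
       value at [z] is. *)
    apply: (@msymMK _ _ (g w)) => //; last by rewrite QE gE.
    apply: contra_neq w0 => gw0; apply: specAL_inj.
    by rewrite -gev gw0 !rmorph0.
  by rewrite -[Q]scale1r -(mulVf e0) -scalerA rpredZ.
have Lchar0 : [pchar L] =i pred0.
  by move=> q; rewrite pchar_lalg; case: hgen.
(* By symmetry this is the coefficient at [staircase v], the number of [s] in [G] with [pi s = 1]:
   positive, hence nonzero in characteristic 0. *)
have cG : Q@_(staircase (t * v)) != 0.
  have -> : staircase (t * v) = [multinom staircase v (( v^-1 * t * v)^-1%g i) | i < N].
    by apply/mnmP => i; rewrite !mnmE -permM !invMg invgK !mulgA mulgK.
  rewrite msym_coeff // raddf_sum /= (eq_bigr (fun s => (pi s == 1%g)%:R)); last first.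
    move=> s _; rewrite mcoeffX (inj_eq staircase_inj).
    by rewrite -{2}[v]mul1g (inj_eq (mulIg v)).
  rewrite -natr_sum (bigD1 1%g) ?group1 //= pi1 eqxx add1n.
  by have /pcharf0P -> := Lchar0.
have [/exists_inP[s sG /eqP pis]|noG] := boolP [exists s in G, pi s == t].
  by exists s => // i; rewrite piE pis.
case/eqP: cG; rewrite raddf_sum big1 // => s sG /=.
rewrite mcoeffX (inj_eq staircase_inj) (inj_eq (mulIg v)).
by move: noG; rewrite negb_exists_in => /forall_inP/(_ s sG)/negbTE ->.
Qed.

End GaloisGroup.

(** * Solvents and eigenvectors *)

(** A nonzero cofactor gives an invertible submatrix, so a kernel vector is determined by the one
    coordinate [j] left out. *)
Lemma adj_kernel (F : fieldType) (n : nat) (B : 'M[F]_n) (x y : 'cV[F]_n) :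
  \adj B != 0 -> B *m x = 0 -> B *m y = 0 -> y != 0 -> exists a, x = a *: y.
Proof.
case: n B x y => [|n] B x y adjB Bx By y0.
  by case/eqP: y0; apply/matrixP => [[]].
have [j [i cofB]] : exists j i, cofactor B i j != 0.
  have [//|noij] := boolP [exists j, exists i, cofactor B i j != 0].
    by move=> /existsP[j /existsP[i ?]]; exists j, i.
  case/eqP: adjB; apply/matrixP => j i; rewrite !mxE; apply/eqP.
  move: noij; rewrite negb_exists => /forallP/(_ j).
  by rewrite negb_exists => /forallP/(_ i)/negPn.
have unitM : row' i (col' j B) \in unitmx.
  by rewrite unitmxE unitfE; apply: contraNneq cofB => d0; rewrite /cofactor d0 mulr0.
have ker0 (w : 'cV_n.+1) : B *m w = 0 -> w j ord0 = 0 -> w = 0.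
  move=> Bw wj.
  have : row' i (col' j B) *m row' j w = 0.
    apply/matrixP => a b; have /matrixP/(_ (lift i a) b) := Bw.
    rewrite !mxE (bigD1_ord j) //= ord1 wj mulr0 add0r => e0; rewrite -[RHS]e0.
    by apply: eq_bigr => q _; rewrite !mxE.
  move/(congr1 (mulmx (invmx (row' i (col' j B))))); rewrite mulKmx // mulmx0 => w0.
  apply/matrixP => a b; rewrite ord1 mxE; case: (unliftP j a) => [a'|] -> //.
  by have /matrixP/(_ a' ord0) := w0; rewrite !mxE.
have yj : y j ord0 != 0 by apply: contra_neq y0; apply: ker0.
exists (x j ord0 / y j ord0); apply/eqP; rewrite -subr_eq0; apply/eqP/ker0.
  by rewrite mulmxBr -scalemxAr Bx By scaler0 subr0.
by rewrite !mxE divfK // subrr.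
Qed.

(** Passes between [eigenvalue], which concerns row vectors, and the column eigenvectors used
    here. *)
Lemma char_poly_trmx (R : comNzRingType) (n : nat) (B : 'M[R]_n) :
  char_poly B^T = char_poly B.
Proof.
rewrite /char_poly -[RHS]det_tr; congr (\det _).
by rewrite /char_poly_mx [RHS]linearB /= tr_scalar_mx map_trmx.
Qed.

Section Solvents.

Variables (F : fieldType) (n k N : nat) (A : 'I_k.+1 -> 'M[F]_n).
Variables (z : 'I_N -> F) (c : F) (v : 'I_N -> 'cV[F]_n).

Implicit Types (X : 'M[F]_n) (x : 'cV[F]_n).

Let lmx (y : F) : 'M[F]_n := \sum_(l < k.+1) y ^+ l *: A l.
Let evmx (X : 'M[F]_n) : 'M[F]_n := \sum_(l < k.+1) A l *m X ^+ l.

Hypotheses (c_neq0 : c != 0) (z_inj : injective z).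
Hypothesis detpE : detp A = c%:P * \prod_(i < N) ('X - (z i)%:P).
Hypothesis lmx_v : forall i, lmx (z i) *m v i = 0.
Hypothesis lmx_ker : forall i x, lmx (z i) *m x = 0 -> exists a, x = a *: v i.
Hypothesis v_free : forall h : 'I_n -> 'I_N, injective h ->
  \matrix_(a, b) v (h b) a ord0 \in unitmx.

Definition eigen_on (X : 'M[F]_n) (S : {set 'I_N}) :=
  forall i, i \in S -> X *m v i = z i *: v i.

Lemma evmx_eigen X x a : X *m x = a *: x -> evmx X *m x = lmx a *m x.
Proof.
move=> Xx; rewrite !mulmx_suml; apply: eq_bigr => l _.
rewrite -mulmxA -scalemxAl scalemxAr; congr (_ *m _).
elim: (l : nat) => [|m IH]; first by rewrite !expr0 scale1r mul1mx.
by rewrite exprSr -mulmxE -mulmxA Xx -scalemxAr IH scalerA exprS.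
Qed.

Lemma enum_subset (S : {set 'I_N}) : #|S| = n ->
  exists2 h : 'I_n -> 'I_N, injective h & forall j, h j \in S.
Proof.
move=> cS; exists (fun j => enum_val (cast_ord (esym cS) j)).
  by move=> a b /enum_val_inj/cast_ord_inj.
by move=> j; apply: enum_valP.
Qed.

Lemma eq_on_eigenvectors (S : {set 'I_N}) (M M' : 'M[F]_n) : #|S| = n ->
  (forall i, i \in S -> M *m v i = M' *m v i) -> M = M'.
Proof.
move=> /enum_subset[h hinj hS] eqM.
apply: (can_inj (mulmxK (v_free hinj))); apply/matrixP => a b.
have /matrixP/(_ a ord0) := eqM _ (hS b); rewrite !mxE => eqab.
by under eq_bigr => q _ do rewrite mxE; under [RHS]eq_bigr => q _ do rewrite mxE.
Qed.

Lemma eigen_on_inj (S : {set 'I_N}) X X' : #|S| = n ->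
  eigen_on X S -> eigen_on X' S -> X = X'.
Proof.
by move=> cS XS X'S; apply: (eq_on_eigenvectors cS) => i iS; rewrite XS ?X'S.
Qed.

Lemma eigen_on_exists (S : {set 'I_N}) : #|S| = n -> exists X, eigen_on X S.
Proof.
move=> cS; have [h hinj hS] := enum_subset cS.
pose V : 'M_n := \matrix_(a, b) v (h b) a ord0.
pose X := V *m diag_mx (\row_b z (h b)) *m invmx V.
have XV : X *m V = V *m diag_mx (\row_b z (h b)) by rewrite mulmxKV ?v_free.
exists X => i iS.
have [b ->] : exists b, i = h b.
  have /eqP hE : h @: setT == S.
    rewrite eqEcard card_imset // cardsT card_ord cS leqnn andbT.
    by apply/subsetP => _ /imsetP[b _ ->].
  by move: iS; rewrite -hE => /imsetP[b _ ->]; exists b.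
apply/matrixP => a b'; have /matrixP/(_ a b) := XV.
rewrite mul_mx_diag ord1 !mxE mulrC => <-.
by apply: eq_bigr => q _; rewrite [V _ _]mxE.
Qed.

Lemma eigen_on_solvent (S : {set 'I_N}) X : #|S| = n ->
  eigen_on X S -> evmx X = 0.
Proof.
move=> cS XS; apply: (eq_on_eigenvectors cS) => i iS.
by rewrite (evmx_eigen (XS i iS)) lmx_v mul0mx.
Qed.

Lemma root_char_poly_eigen X x a : x != 0 -> X *m x = a *: x ->
  root (char_poly X) a.
Proof.
move=> x0 Xx; rewrite -char_poly_trmx -eigenvalue_root_char.
apply/eigenvalueP; exists x^T; last by rewrite trmx_eq0.
by rewrite -trmx_mul Xx linearZ.
Qed.

Lemma eigen_on_card (S : {set 'I_N}) X : (forall i, v i != 0) -> eigen_on X S ->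
  (#|S| <= n)%N.
Proof.
move=> v0 XS; have := @max_poly_roots _ (char_poly X) [seq z i | i in S].
rewrite monic_neq0 ?char_poly_monic // size_char_poly size_image ltnS; apply=> //.
  by apply/allP => _ /imageP[i iS ->]; apply: root_char_poly_eigen (v0 i) (XS i iS).
by rewrite map_inj_uniq ?enum_uniq.
Qed.

(** Each [x^l - X^l] is a left multiple of [x - X]; hence so is the matrix polynomial minus its
    value at [X], here zero. Take determinants. *)
Lemma char_poly_dvd X : evmx X = 0 -> char_poly X %| detp A.
Proof.
move=> eX; pose XC := map_mx polyC X; pose C := char_poly_mx X.
have CX : C *m XC = XC *m C by rewrite mulmxBl mulmxBr scalar_mxC.
have dvdC l : exists Q, 'X%:M ^+ l - XC ^+ l = Q *m C.
  elim: l => [|l [Q IH]]; first by exists 0; rewrite !expr0 subrr mul0mx.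
  exists ('X%:M ^+ l + Q *m XC); rewrite mulmxDl -mulmxA -CX mulmxA -IH.
  by rewrite mulmxBl mulmxBr !exprSr !mulmxE addrA subrK.
have [Q QE] : exists Q : 'I_k.+1 -> 'M_n, forall l : 'I_k.+1, 'X%:M ^+ l - XC ^+ l = Q l *m C.
  have /fin_all_exists := fun l : 'I_k.+1 => dvdC l.
  by [].
have -> : detp A = \det ((\sum_l map_mx polyC (A l) *m Q l) *m C).
  congr (\det _); rewrite mulmx_suml.
  under eq_bigr => l _ do rewrite -mulmxA -QE mulmxBr.
  rewrite sumrB.
  have -> : \sum_(l < k.+1) map_mx polyC (A l) *m XC ^+ l = 0.
    have := congr1 (map_mx polyC) eX; rewrite raddf_sum raddf0 => e0.
    rewrite -[RHS]e0; apply: eq_bigr => l _; rewrite /= map_mxM; congr (_ *m _).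
    by rewrite /XC; elim: (l : nat) => [|m IH]; rewrite ?expr0 ?map_mx1 // !exprS map_mxM IH.
  rewrite subr0; apply/matrixP => i j; rewrite summxE mxE poly_def.
  apply: eq_bigr => l _; rewrite inord_val.
  have -> : 'X%:M ^+ l = ('X^l)%:M :> 'M[{poly F}]_n.
    by elim: (l : nat) => [|m IH]; rewrite // !exprS IH -mulmxE -scalar_mxM.
  by rewrite mul_mx_scalar !mxE mulrC mul_polyC.
by rewrite det_mulmx dvdp_mull.
Qed.

(** A monic divisor of a product of distinct linear factors is a subproduct, here over [n] roots. An
    eigenvector for such a root lies in the kernel line of [v i]. *)
Lemma solvent_eigen_on X : evmx X = 0 ->
  exists2 S : {set 'I_N}, #|S| = n & eigen_on X S.
Proof.
move=> eX; have := char_poly_dvd eX; rewrite detpE mul_polyC dvdpZr //.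
case/dvdp_prod_XsubC => m mE.
have {}mE : char_poly X = \prod_(i <- mask m (index_enum 'I_N)) ('X - (z i)%:P).
  by apply/eqP; rewrite -eqp_monic ?char_poly_monic ?monic_prod_XsubC.
set s := mask m _ in mE.
have us : uniq s by rewrite mask_uniq ?index_enum_uniq.
exists [set i in s].
  have := congr1 (fun q : {poly F} => size q) mE.
  by rewrite size_char_poly size_prod_XsubC cardsE (card_uniqP us) => [[]].
move=> i; rewrite inE => iS.
have : root (char_poly X^T) (z i).
  by rewrite char_poly_trmx mE -(big_map z xpredT (fun y => 'X - y%:P)) root_prod_XsubC map_f.
rewrite -eigenvalue_root_char => /eigenvalueP[x xX x0].
have Xx : X *m x^T = z i *: x^T by rewrite -[X]trmxK -trmx_mul xX linearZ.
have [a xE] : exists a, x^T = a *: v i.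
  by apply: lmx_ker; rewrite -(evmx_eigen Xx) eX mul0mx.
have a0 : a != 0.
  by apply: contraNneq x0 => a0; rewrite -trmx_eq0 xE a0 scale0r.
apply: (scalerI a0); rewrite scalemxAr -xE Xx xE scalerA mulrC -scalerA.
by [].
Qed.

End Solvents.

(** The symmetric group on [T] is [m]-transitive for [m] up to [#|T|], a bound given by the
    injection [h]. *)
Lemma perm_extension (T : finType) (m : nat) (h h' : 'I_m -> T) :
  injective h -> injective h' -> exists s : {perm T}, forall j, s (h j) = h' j.
Proof.
move=> hinj hinj'; have le_m : (m <= #|T|)%N.
  by have := leq_card h hinj; rewrite card_ord.
have dt (f : 'I_m -> T) : injective f -> [tuple f i | i < m] \in m.-dtuple(setT).
  move=> finj; apply/dtuple_onP; split=> [i j|i]; last by rewrite inE.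
  by rewrite !tnth_mktuple => /finj.
have := atransP2 (ntransitive_weak le_m (Sym_trans T)) (dt h hinj) (dt h' hinj').
case=> s _ /= eqt; exists s => j.
have := congr1 (fun t => tnth t j) eqt; rewrite /= tnth_mktuple tnth_map tnth_mktuple.
by move=> ->.
Qed.

(** * Eigenvectors from the adjugate *)

Section Eigenvectors.

Variables (n k : nat) (K : fieldType) (A : 'I_k.+1 -> 'M[K]_n.+1).
Local Notation N := (k * n.+1)%N.
Variables (L : splittingFieldType K) (z : 'I_N -> L) (c : L).
Hypotheses (k_gt0 : (0 < k)%N) (c_neq0 : c != 0) (z_inj : injective z).
Hypothesis zE : map_poly (in_alg L) (detp A) = c%:P * \prod_(i < N) ('X - (z i)%:P).
Hypothesis full : forall t : 'S_N, exists s : gal_of {:L}, forall i, s (z i) = z (t i).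

Let ev (x : L) : {poly K} -> L := horner_eval x \o map_poly (in_alg L).
HB.instance Definition _ x := GRing.RMorphism.on (ev x).

(** At a root of [detp A] the matrix times its adjugate vanishes, so this column lies in the
    kernel. *)
Definition eigenvec (x : L) : 'cV[L]_n.+1 :=
  map_mx (ev x) (col ord0 (\adj (mxp A))).

Let lmx (x : L) : 'M[L]_n.+1 := map_mx (ev x) (mxp A).

Lemma lmxE x : lmx x = \sum_(l < k.+1) x ^+ l *: map_mx (in_alg L) (A l).
Proof.
rewrite -(horner_mxp (fun l => map_mx (in_alg L) (A l))) mxp_map.
by apply/matrixP => i j; rewrite !mxE.
Qed.

Lemma ev_detp i : ev (z i) (detp A) = 0.
Proof.
rewrite /ev /= /horner_eval zE hornerM horner_prod (bigD1 i) //=.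
by rewrite hornerXsubC subrr mul0r mulr0.
Qed.

Lemma lmx_adj i : lmx (z i) *m \adj (lmx (z i)) = 0.
Proof.
have det0 : \det (lmx (z i)) = 0 by rewrite det_map_mx; apply: ev_detp.
rewrite mul_mx_adj det0.
by apply/matrixP => a b; rewrite !mxE mul0rn.
Qed.

Lemma eigenvec_adj x : eigenvec x = col ord0 (\adj (lmx x)).
Proof. by rewrite -map_mx_adj; apply/matrixP => a b; rewrite !mxE. Qed.

Lemma lmx_eigenvec i : lmx (z i) *m eigenvec (z i) = 0.
Proof. by rewrite eigenvec_adj colE mulmxA lmx_adj mul0mx. Qed.

Lemma roots_small_poly (q : {poly L}) : (size q <= N)%N ->
  (forall i, q.[z i] = 0) -> q = 0.
Proof.
move=> szq q0; apply/eqP; apply: contraTT szq => nzq; rewrite -ltnNge.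
have := @max_poly_roots _ q (codom z) nzq; rewrite size_codom card_ord; apply.
  by apply/allP => _ /codomP[i ->]; apply/eqP.
by rewrite map_inj_uniq ?enum_uniq.
Qed.

Lemma size_adj_mxp i j : (size (\adj (mxp A) i j) <= N)%N.
Proof.
rewrite mxE (leq_trans (size_cofactor_mxp _ _ _)) //= mulnS.
by rewrite -[k in (_ <= k + _)%N]prednK // addSn ltnS leq_addl.
Qed.

Lemma detp_neq0 : detp A != 0.
Proof.
rewrite -(map_poly_eq0 (in_alg L)) zE mulf_neq0 ?polyC_eq0 //.
by rewrite monic_neq0 ?monic_prod_XsubC.
Qed.

Lemma ev_gal (s : gal_of {:L}) x q : ev (s x) q = s (ev x q).
Proof.
rewrite /ev /= /horner_eval -horner_map; congr (_.[_]).
by apply/polyP => m; rewrite !coef_map /= linearZ /= rmorph1.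
Qed.

(* An entry of the column is a nonzero polynomial over K of degree less than
   that of detp A, whose roots are conjugate. *)
Lemma eigenvec_neq0 i : eigenvec (z i) != 0.
Proof.
have [j adj0] : exists j, \adj (mxp A) j ord0 != 0.
  apply/existsP; apply: contraT; rewrite negb_exists => /forallP adj0.
  case/eqP: detp_neq0; have /matrixP/(_ ord0 ord0) := mul_mx_adj (mxp A).
  rewrite mxE big1 => [|a _]; last by rewrite (eqP (negPn (adj0 a))) mulr0.
  by rewrite mxE eqxx mulr1n.
apply: contraNneq adj0 => ez0; rewrite -(map_poly_eq0 (in_alg L)).
apply/eqP/roots_small_poly => [|i']; first by rewrite size_map_poly size_adj_mxp.
(* An automorphism exchanging two roots carries the zero at [z i] to [z i']. *)
have [s sz] := full (tperm i i').
have := sz i; rewrite tpermL => <-; rewrite -[LHS]/(ev _ _) ev_gal.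
have /matrixP/(_ j ord0) := ez0; rewrite !mxE => ->.
exact: rmorph0.
Qed.

Lemma adj_lmx_neq0 i : \adj (lmx (z i)) != 0.
Proof.
by apply: contraNneq (eigenvec_neq0 i) => adj0; rewrite eigenvec_adj adj0 raddf0.
Qed.

(** All columns of the adjugate at [z i] are multiples of [eigenvec (z i)], so [W] vanishes at every
    root, and its degree is below [N]. Multiplying [W = 0] by the matrix leaves [detp A] times
    [w]. *)
Lemma eigenvec_span (w : 'rV[L]_n.+1) :
  (forall i, w *m eigenvec (z i) = 0) -> w = 0.
Proof.
move=> w0; pose W := map_mx polyC w *m map_mx (map_poly (in_alg L)) (\adj (mxp A)).
have W0 : W = 0.
  apply/matrixP => a b; rewrite [RHS]mxE; apply: roots_small_poly => [|i].
    rewrite mxE; apply: leq_trans (size_sum _ _ _) _; apply/bigmax_leqP => q _.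
    rewrite !mxE mul_polyC; apply: leq_trans (size_scale_leq _ _) _.
    by rewrite size_map_poly -[cofactor _ _ _]/(_) ; have := size_adj_mxp q b; rewrite mxE.
  have [d colE] : exists d, col b (\adj (lmx (z i))) = d *: eigenvec (z i).
    apply: adj_kernel (adj_lmx_neq0 i) _ (lmx_eigenvec i) (eigenvec_neq0 i).
    by rewrite colE mulmxA lmx_adj mul0mx.
  have : w *m col b (\adj (lmx (z i))) = 0 by rewrite colE -scalemxAr w0 scaler0.
  move/matrixP/(_ a ord0); rewrite -map_mx_adj !mxE horner_sum => e0.
  rewrite -[RHS]e0; apply: eq_bigr => q _.
  by rewrite hornerM !mxE hornerC.
apply/matrixP => a b; rewrite [RHS]mxE.
have : W *m map_mx (map_poly (in_alg L)) (mxp A) = 0 by rewrite W0 mul0mx.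
rewrite /W -mulmxA -map_mxM mul_adj_mx map_scalar_mx mul_mx_scalar.
move/matrixP/(_ a b)/eqP; rewrite !mxE mulf_eq0 map_poly_eq0 -/(detp A).
by rewrite (negbTE detp_neq0) polyC_eq0 => /eqP.
Qed.

(** The vectors span, so some [n.+1] of them form a basis; an automorphism maps its determinant to
    the one for [h]. *)
Lemma eigenvec_free (h : 'I_n.+1 -> 'I_N) : injective h ->
  \matrix_(a, b) eigenvec (z (h b)) a ord0 \in unitmx.
Proof.
move=> hinj; rewrite unitmxE unitfE; pose M : 'M[L]_(N, n.+1) := \matrix_(i, a) eigenvec (z i) a ord0.
have fullM : row_full M.
  rewrite /row_full -mxrank_tr -/(row_free _) -kermx_eq0.
  apply/eqP/row_matrixP => r; rewrite row0; apply: eigenvec_span => i.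
  have /matrixP/(_ r i) := mulmx_ker M^T; rewrite !mxE => e0.
  apply/matrixP => a b; rewrite !ord1 !mxE -[RHS]e0.
  by apply: eq_bigr => q _; rewrite !mxE.
have [s sE] := perm_extension (@fullrankfun_inj _ _ _ _ fullM) hinj.
have [g gE] := full s.
have : \det (rowsub (fullrankfun fullM) M) != 0.
  by rewrite -unitfE -unitmxE fullrowsub_unit.
rewrite -det_tr; apply: contra_neq => det0; apply: (fmorph_inj g).
rewrite rmorph0 -det0 -det_map_mx; congr (\det _).
by apply/matrixP => a b; rewrite !mxE -sE -gE ev_gal.
Qed.

End Eigenvectors.

(** * The field generated by the solvents *)

Lemma minimal_annihilator (K E : fieldType) (iota : {rmorphism K -> E}) (x : E) :
  algebraicOver iota x ->
  exists r : {poly K}, [/\ r != 0, root (map_poly iota r) x & irreducible_poly r].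
Proof.
case=> p p0 px.
suff [r [r0 rx rmin]] : exists r : {poly K}, [/\ r != 0, root (map_poly iota r) x &
    forall q, root (map_poly iota q) x -> q != 0 -> (size r <= size q)%N].
  by exists r; split=> //; apply/(subfx_irreducibleP rx r0).
have [m szm] := ubnP (size p); elim: m p p0 px szm => // m IH p p0 px szp.
have [[q [q0 qx ltq]]|nq] := classic (exists q : {poly K},
    [/\ q != 0, root (map_poly iota q) x & (size q < size p)%N]).
  by apply: IH q0 qx _; rewrite (leq_trans ltq) // -ltnS.
exists p; split=> // q qx q0; rewrite leqNgt; apply/negP => ltq; apply: nq.
by exists q.
Qed.

(** * Finite extensions inside an algebraic extension *)

Section SubfieldOfClosure.

Variables (K E : fieldType) (iota : {rmorphism K -> E}).
Hypotheses (char0 : [pchar K] =i pred0).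
Hypothesis algE : forall x, algebraicOver iota x.

(** Natural coefficients keep [x] in every field containing [s], which later shows that [s]
    generates the extension. *)
Lemma primitive_element_seq (s : seq E) :
  exists x, (exists a : nat ^ size s, x = \sum_(i < size s) s`_i *+ a i)
    /\ exists ps, s = [seq (map_poly iota p).[x] | p <- ps].
Proof.
elim: s => [|y s [x [[a Dx] [ps Ds]]]].
  (* The index type is empty, so the coefficient 2 is arbitrary. *)
  by exists 0; split; [exists [ffun _ => 2%N]; rewrite big_ord0 | exists nil].
(* The primitive element for a pair comes as a difference; [- x] turns it into a sum. *)
have [r r0 rx] := algE (- x); have [q q0 qy] := algE y.
have [m [[px Dpx] [py Dpy]]] := pchar0_PET r0 rx q0 qy char0.
rewrite opprK in Dpx Dpy; exists (y *+ m + x); split.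
  exists [ffun i => oapp a m (unlift ord0 i)].
  rewrite /= big_ord_recl ffunE unlift_none Dx; congr (_ + _).
  by apply: eq_bigr => i _; rewrite ffunE liftK.
exists (py :: [seq p \Po - px | p <- ps]); rewrite /= Dpy; congr (_ :: _).
rewrite -map_comp [LHS]Ds; apply: eq_map => p /=.
by rewrite map_comp_poly horner_comp raddfN hornerN Dpx opprK.
Qed.

(** [L] is [{poly K}] modulo an irreducible annihilator of a primitive element; the members of [s]
    are polynomials in that element and lift. *)
Lemma finite_extension_generated_by (s : seq E) :
  exists (L : fieldExtType K) (j : {rmorphism L -> E}) (zs : seq L),
    [/\ forall a, j a%:A = iota a, map j zs = s & <<1 & zs>>%VS = {:L}%VS].
Proof.
have [x [[a Dx] [ps Ds]]] := primitive_element_seq s.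
have [r [r0 rx irr_r]] := minimal_annihilator (algE x).
pose L := SubFieldExtType rx irr_r.
pose j : {rmorphism L -> E} := @subfx_inj _ _ iota x r.
have jE b : j b%:A = iota b by exact: subfx_inj_base.
pose x1 : L := subfx_root iota x r.
have jx1 : j x1 = x by exact: subfx_inj_root.
pose inL (p : {poly K}) : L := (map_poly (in_alg L) p).[x1].
have jinL p : j (inL p) = (map_poly iota p).[x].
  rewrite /inL -horner_map jx1 -map_poly_comp; congr (_.[_]).
  by apply: eq_map_poly => b; apply: jE.
exists L, j, (map inL ps); split=> //.
  by rewrite -map_comp Ds; apply: eq_map => p; apply: jinL.
have sz_ps : size ps = size s by rewrite Ds size_map.
apply/vspaceP => y; rewrite memvf; have [p ->] := subfxEroot rx r0 y.
rewrite -[_.[_]]/(inL p) /inL.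
suff x1in : x1 \in <<1 & map inL ps>>%VS.
  apply: rpred_horner x1in; apply: (polyOverSv (sub1v _)); exact: alg_polyOver.
have -> : x1 = \sum_(i < size s) (map inL ps)`_i *+ a i.
  apply: (fmorph_inj j); rewrite jx1 Dx rmorph_sum; apply: eq_bigr => i _.
  by rewrite rmorphMn {1}Ds !(nth_map 0) ?sz_ps //= jinL.
rewrite memv_suml // => i _.
by rewrite rpredMn ?seqv_sub_adjoin ?mem_nth // size_map sz_ps.
Qed.

End SubfieldOfClosure.

Lemma splitting_field_in_closure (K : fieldType) (Kbar : closedFieldType)
    (iota : {rmorphism K -> Kbar}) (p : {poly K}) :
  [pchar K] =i pred0 -> is_algebraic_closure iota -> p != 0 ->
  exists (L : splittingFieldType K) (j : {rmorphism L -> Kbar}) (zs : seq L),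
    [/\ forall a, j a%:A = iota a,
        map_poly (in_alg L) p = (lead_coef p)%:A *: \prod_(x <- zs) ('X - x%:P)
      & <<1 & zs>>%VS = {:L}%VS].
Proof.
move=> char0 algK p0; have [rs rsE] := closed_field_poly_normal (map_poly iota p).
have [L [j [zs [jE zsE zsgen]]]] := finite_extension_generated_by char0 algK rs.
have pE : map_poly (in_alg L) p = (lead_coef p)%:A *: \prod_(x <- zs) ('X - x%:P).
  apply: (map_poly_inj j); rewrite -map_poly_comp map_polyZ rmorph_prod /=.
  rewrite jE (eq_map_poly jE) rsE lead_coef_map; congr (_ *: _).
  by rewrite -zsE big_map; apply: eq_bigr => x _; rewrite map_polyXsubC.
have splitL : SplittingField.axiom L.
  exists (map_poly (in_alg L) p); first exact: alg_polyOver.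
  exists zs => //; rewrite pE eqp_scale //.
  by rewrite scaler_eq0 oner_eq0 orbF lead_coef_eq0.
pose L' : splittingFieldType K :=
  HB.pack L (FieldExt_isSplittingField.Build K L splitL).
exists L', j, zs; split; [exact: jE | exact: pE | exact: zsgen].
Qed.

Lemma entries_of_map (R S : Type) (n : nat) (f : R -> S) (s : seq 'M[R]_n) :
  entries_of [seq map_mx f X | X <- s] = map f (entries_of s).
Proof.
rewrite /entries_of map_allpairs allpairs_mapl; apply: eq_allpairs => // X ij.
by rewrite mxE.
Qed.

Lemma subset_of_card (T : finType) (A : {set T}) m : (m <= #|A|)%N ->
  exists2 B : {set T}, B \subset A & #|B| = m.
Proof.
move=> /card_geqP[s [us ss sA]]; exists [set x in s].
  by apply/subsetP => x; rewrite inE; apply: sA.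
by rewrite cardsE (card_uniqP us).
Qed.

(** * Solvents indexed by subsets of the roots *)

Section SolventField.

Variables (n k : nat) (K : fieldType) (A : 'I_k.+1 -> 'M[K]_n.+1).
Local Notation N := (k * n.+1)%N.
Variables (L : splittingFieldType K) (z : 'I_N -> L) (c : L).
Hypotheses (k_gt1 : (1 < k)%N) (c_neq0 : c != 0) (z_inj : injective z).
Hypothesis zE : map_poly (in_alg L) (detp A) = c%:P * \prod_(i < N) ('X - (z i)%:P).
Hypothesis zgen : <<1 & codom z>>%VS = {:L}%VS.
Hypothesis perm_roots : exists pi : gal_of {:L} -> 'S_N,
  forall (s : gal_of {:L}) i, s (z i) = z (pi s i).
Hypothesis galoisL : galois 1 {:L}.
Hypothesis full : forall t : 'S_N,
  exists2 s, s \in ('Gal({:L} / 1))%g & forall i, s (z i) = z (t i).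

Let k_gt0 : (0 < k)%N. Proof. exact: ltnW. Qed.

Let full' (t : 'S_N) : exists s : gal_of {:L}, forall i, s (z i) = z (t i).
Proof. by have [s _ sE] := full t; exists s. Qed.

Let v i := eigenvec A (z i).

Lemma gal_fix_roots (s : gal_of {:L}) : (forall i, s (z i) = z i) -> s = 1%g.
Proof.
move=> sz; apply/eqP/gal_eqP => x _; rewrite gal_id.
have : x \in <<1 & codom z>>%VS by rewrite zgen memvf.
suff /subvP sub : (<<1 & codom z>> <= fixedField [set s])%VS.
  by move/sub/fixedFieldP => -> //; rewrite ?memvf ?inE.
apply/Fadjoin_seqP; split; first exact: sub1v.
move=> _ /codomP[i ->]; apply/fixedFieldP; first exact: memvf.
by move=> g; rewrite inE => /eqP ->.
Qed.

Lemma gal_isog_Sym : ('Gal({:L} / 1) \isog [set: 'S_N])%g.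
Proof.
have [pi piE] := perm_roots.
have piM : {in 'Gal({:L} / 1)%g &, {morph pi : s t / (s * t)%g >-> (s * t)%g}}.
  move=> s t _ _; apply/permP => i; apply: z_inj.
  by rewrite -piE galM ?memvf // !piE permM.
apply/isogP; exists (Morphism piM).
  apply/injmP => s t _ _ /= eqp; apply/eqP; rewrite -(inj_eq (mulIg t^-1%g)) mulgV.
  apply/eqP/gal_fix_roots => i.
  rewrite galM ?memvf // piE eqp -piE -galM ?memvf // mulgV.
  by rewrite gal_id.
apply/setP => t; rewrite [RHS]inE; apply/morphimP.
have [s sG sE] := full t; exists s => //; apply/permP => i; apply: z_inj.
by rewrite -sE piE.
Qed.

Section Extension.

Variables (E : fieldType) (j : {rmorphism L -> E}).

(** Solvents are counted over an extension [E] of [L], so kernels and independence are transported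
    along [j]. *)
Let B (l : 'I_k.+1) : 'M[E]_n.+1 := map_mx j (map_mx (in_alg L) (A l)).

Let lmxjE i : \sum_(l < k.+1) (j (z i)) ^+ l *: B l
  = map_mx j (\sum_(l < k.+1) (z i) ^+ l *: map_mx (in_alg L) (A l)).
Proof.
by rewrite raddf_sum; apply: eq_bigr => l _; rewrite /= map_mxZ rmorphXn.
Qed.

Lemma ext_lmx_v i : (\sum_(l < k.+1) (j (z i)) ^+ l *: B l) *m map_mx j (v i) = 0.
Proof.
by rewrite lmxjE -map_mxM -lmxE (lmx_eigenvec zE) raddf0.
Qed.

Lemma ext_lmx_ker i (x : 'cV_n.+1) :
  (\sum_(l < k.+1) (j (z i)) ^+ l *: B l) *m x = 0 ->
  exists a, x = a *: map_mx j (v i).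
Proof.
move=> Bx; apply: (adj_kernel _ Bx (ext_lmx_v i)).
  rewrite lmxjE -map_mx_adj map_mx_eq0 -lmxE.
  exact: adj_lmx_neq0 k_gt0 c_neq0 z_inj zE full' i.
by rewrite map_mx_eq0; exact: eigenvec_neq0 k_gt0 c_neq0 z_inj zE full' i.
Qed.

Lemma ext_v_free (h : 'I_n.+1 -> 'I_N) : injective h ->
  \matrix_(a, b) (map_mx j (v (h b))) a ord0 \in unitmx.
Proof.
move=> /(eigenvec_free k_gt0 c_neq0 z_inj zE full'); rewrite -(map_unitmx j).
by congr (_ \in unitmx); apply/matrixP => a b; rewrite !mxE.
Qed.

Lemma ext_detpE : detp B = (j c)%:P * \prod_(i < N) ('X - (j (z i))%:P).
Proof.
rewrite /B detp_map detp_map zE rmorphM /= map_polyC rmorph_prod; congr (_ * _).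
by apply: eq_bigr => i _; rewrite /= map_polyXsubC.
Qed.

End Extension.

Variable XL : {set 'I_N} -> 'M[L]_n.+1.
Hypothesis XLE : forall S : {set 'I_N}, #|S| = n.+1 -> eigen_on z v (XL S) S.

Let sols := [seq XL B | B <- enum [set B : {set 'I_N} | #|B| == n.+1]].

Let v_neq0 i : v i != 0.
Proof. exact: eigenvec_neq0 k_gt0 c_neq0 z_inj zE full' i. Qed.

(** Applying [s] makes [v (t i)] an eigenvector of the unchanged matrix; with [t i] outside [S], a
    matrix of size [n.+1] would have [n.+2] eigenvalues. *)
Lemma XL_gal (s : gal_of {:L}) (t : 'S_N) i (S : {set 'I_N}) : #|S| = n.+1 ->
  i \in S -> map_mx s (XL S) = XL S -> (forall i, s (z i) = z (t i)) ->
  t i \in S.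
Proof.
move=> cS iS fixX st; apply: contraT => tiS.
have : eigen_on z v (XL S) (t i |: S).
  move=> a; rewrite !inE => /orP[/eqP ->|]; last exact: XLE.
  have sv : map_mx s (v i) = v (t i).
    by apply/matrixP => b d; rewrite /v -st !mxE ev_gal.
  by rewrite -sv -{1}fixX -map_mxM XLE // map_mxZ; congr (_ *: _); apply: st.
move/(eigen_on_card z_inj v_neq0).
by rewrite cardsU1 tiS cS ltnn.
Qed.

(** By the Galois correspondence, only the identity may fix all entries. If [s] moved the root [i],
    a subset containing [i] but not [t i] would contradict [XL_gal]. *)
Lemma solvent_entries_generate : <<1 & entries_of sols>>%VS = {:L}%VS.
Proof.
pose E : {subfield L} := <<1 & entries_of sols>>%AS.
have galE : galois E {:L} by apply: galoisS galoisL; rewrite sub1v subvf.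
apply/eqP; rewrite eqEsubv subvf /= -/(E : {vspace L}).
rewrite -(galois_fixedField galE); apply/subvP => x _; apply/fixedFieldP.
  exact: memvf.
move=> s sG; suff -> : s = 1%g by rewrite gal_id.
apply: gal_fix_roots => i; have [pi piE] := perm_roots; rewrite piE.
pose t := pi s; rewrite -/t; congr (z _); apply: contraTeq isT => ti.
have [B BS cB] : exists2 B : {set 'I_N}, B \subset ~: [set i; t i] & #|B| = n.
  apply: subset_of_card; have := cardsC [set i; t i].
  rewrite cards2 eq_sym ti card_ord /= => eqN.
  (* This is where [1 < k] enters: [n + 2 <= 2 * n.+1 <= N] leaves room for [B]. *)
  rewrite -(leq_add2l 2) eqN (leq_trans _ (leq_mul k_gt1 (leqnn n.+1))) //.
  by rewrite mul2n -addnn addSn addnS !ltnS leq_addr.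
have iB : i \notin B by apply/negP => /(subsetP BS); rewrite !inE eqxx.
have tB : t i \notin B by apply/negP => /(subsetP BS); rewrite !inE eqxx orbT.
have cS : #|i |: B| = n.+1 by rewrite cardsU1 iB cB.
have := @XL_gal s t i (i |: B) cS (setU11 _ _) _ (piE s).
rewrite !inE (negbTE ti) (negbTE tB) => abs; apply: abs.
apply/matrixP => a b; rewrite !mxE; apply: (fixed_gal (subvf E) sG).
apply: seqv_sub_adjoin; apply/allpairsP; exists (XL (i |: B), (a, b)).
split=> //; last by rewrite mem_enum.
by apply/mapP; exists (i |: B); rewrite // mem_enum inE cS.
Qed.

Lemma solvents_over_extension (E : fieldType) (j : {rmorphism L -> E}) :
  let solsE := [seq map_mx j X | X <- sols] in
  [/\ uniq solsE, size solsE = 'C(N, n.+1)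
    & forall X, X \in solsE <->
        \sum_(l < k.+1) map_mx j (map_mx (in_alg L) (A l)) *m X ^+ l = 0].
Proof.
have jXLE (S : {set 'I_N}) : #|S| = n.+1 ->
    eigen_on (j \o z) (fun i => map_mx j (v i)) (map_mx j (XL S)) S.
  by move=> cS i iS; rewrite -map_mxM XLE // map_mxZ.
split.
- rewrite -map_comp map_inj_in_uniq ?enum_uniq // => S S'.
  rewrite !mem_enum !inE => /eqP cS /eqP cS' /= /map_mx_inj eqX.
  (* A matrix shared by two subsets has an eigenvector for each root in their union, which thus has
     at most [n.+1] elements. *)
  have : eigen_on z v (XL S) (S :|: S').
    by move=> i; rewrite inE => /orP[|iS']; [exact: XLE | rewrite eqX XLE].
  move/(eigen_on_card z_inj v_neq0) => cU.
  have eqU (T : {set 'I_N}) : #|T| = n.+1 -> T \subset S :|: S' -> T = S :|: S'.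
    by move=> cT sT; apply/eqP; rewrite eqEcard sT cT.
  by rewrite [LHS]eqU ?subsetUl // [RHS]eqU ?subsetUr.
- by rewrite !size_map -cardE card_draws card_ord.
move=> X; split.
  rewrite -map_comp => /mapP[S]; rewrite mem_enum inE => /eqP cS ->.
  apply: eigen_on_solvent cS (jXLE S cS); first exact: ext_lmx_v.
  exact: ext_v_free.
move=> solX; have jc : j c != 0 by rewrite fmorph_eq0.
have [S cS XS] := solvent_eigen_on jc (ext_detpE j) (@ext_lmx_ker _ j) solX.
have -> : X = map_mx j (XL S).
  exact: eigen_on_inj (@ext_v_free _ j) _ _ _ cS XS (jXLE S cS).
by apply/map_f/map_f; rewrite mem_enum inE cS.
Qed.

End SolventField.

Lemma eigen_matrices_exist (F : fieldType) (n N : nat) (z : 'I_N -> F)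
    (v : 'I_N -> 'cV[F]_n) :
  (forall h : 'I_n -> 'I_N, injective h -> \matrix_(a, b) v (h b) a ord0 \in unitmx) ->
  exists X : {set 'I_N} -> 'M[F]_n, forall S : {set 'I_N}, #|S| = n -> eigen_on z v (X S) S.
Proof.
move=> v_free; have ex (S : {set 'I_N}) : exists X, #|S| = n -> eigen_on z v X S.
  have [cS|cS] := eqVneq #|S| n; last by exists 0 => cS'; rewrite cS' eqxx in cS.
  by have [X XS] := eigen_on_exists z v_free cS; exists X.
exact: fin_all_exists ex.
Qed.

Theorem corollary1 (k n : nat) (hk : (2 <= k)%N) (hn : (2 <= n)%N)
    (K : fieldType) (A : 'I_k.+1 -> 'M[K]_n)
    (hgen : generic_matrices A)
    (hK : field_generated_by (all_entries A))
    (Kbar : closedFieldType) (iota : {rmorphism K -> Kbar})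
    (hKbar : is_algebraic_closure iota) :
  solvability_complexity iota
    (fun X : 'M[Kbar]_n => \sum_(i < k.+1) map_mx iota (A i) *m X ^+ i = 0)
    'C(k * n, n) [set: 'S_(k * n)]%G.
Proof.
case: n hn A hgen hK => // n _ A hgen hK.
have k0 : (0 < k)%N by apply: ltnW.
have specA_inj : injective (spec A) by apply: spec_inj; case: hgen.
have leadA : (detp A)`_(k * n.+1) != 0.
  rewrite -(spec_detp A) coef_map /= -(rmorph0 (spec A)) (inj_eq specA_inj).
  exact: lead_detp_genmx.
have szA : size (detp A) = (k * n.+1).+1.
  apply/eqP; rewrite eqn_leq size_detp ltnNge; apply: contraNN leadA => szA.
  by rewrite nth_default.
have detA0 : detp A != 0 by rewrite -size_poly_gt0 szA.
have [L [j [zs [jE zsE zsgen]]]] :=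
  splitting_field_in_closure (proj1 hgen) hKbar detA0.
pose c : L := (lead_coef (detp A))%:A.
have c_neq0 : c != 0 by rewrite scaler_eq0 oner_eq0 orbF lead_coef_eq0.
have szzs : size zs = (k * n.+1)%N.
  have := congr1 (fun p : {poly L} => size p) zsE.
  by rewrite /= size_map_poly szA size_scale // size_prod_XsubC => [[]].
pose z (i : 'I_(k * n.+1)) : L := zs`_i.
have codomz : codom z = zs.
  apply: (@eq_from_nth _ 0) => [|i]; first by rewrite size_codom card_ord szzs.
  rewrite size_codom card_ord => lti.
  by rewrite (nth_map (Ordinal lti)) -?enumT ?size_enum_ord // /z nth_enum_ord.
have zgen : <<1 & codom z>>%VS = {:L}%VS by rewrite codomz.
have zE : map_poly (in_alg L) (detp A) = c%:P * \prod_(i < k * n.+1) ('X - (z i)%:P).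
  by rewrite mul_polyC zsE -[in LHS]codomz big_image.
have z_inj : injective z := generic_roots_inj k0 hgen zE.
have full := generic_galois_full k0 hgen hK zE zgen.
have galL := generic_galois k0 hgen zE zgen.
have perm_roots := root_permutations k0 hgen zE.
have full' (t : 'S_(k * n.+1)) : exists s : gal_of {:L}, forall i, s (z i) = z (t i).
  by have [s _ sE] := full t; exists s.
have [XL XLE] := @eigen_matrices_exist _ _ _ z (fun i => eigenvec A (z i))
  (eigenvec_free k0 c_neq0 z_inj zE full').
have [us ss solE] := solvents_over_extension hk c_neq0 z_inj zE full XLE j.
(* The solvents are built over [L] and carried into [Kbar] by [j]; [solE] says that there are no
   others. *)
exists [seq map_mx j X | X <- [seq XL B | B <- enum [set B : {set 'I_(k * n.+1)} | #|B| == n.+1]]].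
split=> // [X|].
  apply: (iff_trans (solE X)).
  suff -> : \sum_(l < k.+1) map_mx j (map_mx (in_alg L) (A l)) *m X ^+ l
      = \sum_(i < k.+1) map_mx iota (A i) *m X ^+ i by [].
  apply: eq_bigr => l _; congr (_ *m _); apply/matrixP => a b.
  by rewrite !mxE; apply: jE.
exists (detp A), L, j, (entries_of [seq XL B | B <- enum [set B : {set 'I_(k * n.+1)} | #|B| == n.+1]]).
split.
- exact: jE.
- by rewrite entries_of_map.
- by have := solvent_entries_generate hk c_neq0 z_inj zE zgen perm_roots galL full XLE.
- exact: generic_splittingField hgen zE zgen.
exact: gal_isog_Sym z_inj zgen perm_roots full.
Qed.
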